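(* Let $(X,d)$ be a compact metric space and let $\mathcal{F}=\{f_1,\dots,f_k\}$ be a finite family of maps $f_i:X\to X$ such that each inverse relation $f_i^{-1}$, $i=1,\dots,k$, is a continuous relation. If $\mathrm{IFS}(X;\mathcal{F})$ is weak topologically exact but not minimal, then $\mathrm{IFS}(X;\mathcal{F})$ is sensitive.
   Context: A relation $f:X\to X$ is a subset $f\subseteq X\times X$; write $f(x)=\{y:(x,y)\in f\}$, $f(A)=\bigcup_{x\in A}f(x)$, $f^{-1}=\{(y,x):(x,y)\in f\}$; maps are identified with their graphs. A relation $f$ is closed if it is a closed subset of $X\times X$, lower semi-continuous if $f^{-1}(B)$ is open for every open $B\subseteq X$, and continuous if it is both closed and lower semi-continuous. $\mathcal{F}^+$ is the semigroup of all compositions of finitely many (at least one) elements of $\mathcal{F}$, and $\mathrm{IFS}(X;\mathcal{F})$ is the associated iterated function system. It is weak topologically exact if for every nonempty open set $U\subseteq X$ there are finitely many $T_1,\dots,T_N\in\mathcal{F}^+$ such that $\bigcup_{i=1}^N T_i(U)$ is dense in $X$. It is minimal if for every $x\in X$ the forward orbit $\{h(x):h\in\mathcal{F}^+\}$ is dense in $X$. For $\omega=(\omega_1\omega_2\dots)\in\{1,\dots,k\}^{\mathbb{N}}$ put $f_\omega^0=\mathrm{Id}$ and $f_\omega^n=f_{\omega_n}\circ f_\omega^{n-1}$ for $n\ge1$. Define $d_{\mathcal{F}}(x_1,x_2)=\sup_{\omega,\,n\ge0}d(f_\omega^n(x_1),f_\omega^n(x_2))$. $\mathrm{IFS}(X;\mathcal{F})$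 is sensitive if there is $\varepsilon>0$ such that every nonempty open subset of $X$ has $d_{\mathcal{F}}$-diameter at least $\varepsilon$. *)

(* Defs.v *)
From HB Require Import structures.
From mathcomp Require Import all_boot all_order all_algebra.
From mathcomp Require Import all_classical all_reals all_analysis.

Set Implicit Arguments.
Unset Strict Implicit.
Unset Printing Implicit Defensive.

Import Order.TTheory GRing.Theory Num.Theory.
Import numFieldNormedType.Exports.
Local Open Scope classical_set_scope.
Local Open Scope ring_scope.

Definition rel_image (X : Type) (f : set (X * X)) (A : set X) : set X :=
  [set y | exists2 x, A x & f (x, y)].

Definition rel_inv (X : Type) (f : set (X * X)) : set (X * X) :=
  [set p | f (p.2, p.1)].

Definition map_graph (X : Type) (g : X -> X) : set (X * X) :=
  [set p | p.2 = g p.1].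

Definition rel_lsc (X : topologicalType) (f : set (X * X)) : Prop :=
  forall B : set X, open B -> open (rel_image (rel_inv f) B).

Definition rel_continuous (X : topologicalType) (f : set (X * X)) : Prop :=
  closed f /\ rel_lsc f.

Inductive ifs_semigroup (X : Type) (k : nat) (f : 'I_k -> X -> X) :
    (X -> X) -> Prop :=
| ifs_gen (i : 'I_k) : ifs_semigroup f (f i)
| ifs_comp (g h : X -> X) :
    ifs_semigroup f g -> ifs_semigroup f h -> ifs_semigroup f (g \o h).

Definition weak_top_exact (X : topologicalType) (k : nat)
    (f : 'I_k -> X -> X) : Prop :=
  forall U : set X, open U -> U !=set0 ->
    exists (N : nat) (T : 'I_N -> X -> X),
      (forall i, ifs_semigroup f (T i)) /\
      dense (\bigcup_(i in [set: 'I_N]) (T i @` U)).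

Definition forward_orbit (X : Type) (k : nat) (f : 'I_k -> X -> X) (x : X) :
    set X :=
  [set y | exists2 h, ifs_semigroup f h & h x = y].

Definition ifs_minimal (X : topologicalType) (k : nat) (f : 'I_k -> X -> X) :
    Prop :=
  forall x : X, dense (forward_orbit f x).

(* Sequences are indexed from 0: the letter omega_(n+1) is [w n]. *)
Fixpoint ifs_iter (X : Type) (k : nat) (f : 'I_k -> X -> X)
    (w : nat -> 'I_k) (n : nat) : X -> X :=
  if n is m.+1 then f (w m) \o ifs_iter f w m else id.

(* Suprema are taken in the extended reals, so no boundedness is needed for
   them to be meaningful. *)
Definition ifs_dist (R : realType) (X : metricType R) (k : nat)
    (f : 'I_k -> X -> X) (x1 x2 : X) : \bar R :=
  ereal_sup [set e | exists (w : nat -> 'I_k) (n : nat),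
    e = (mdist (ifs_iter f w n x1) (ifs_iter f w n x2))%:E].

Definition ifs_diam (R : realType) (X : metricType R) (k : nat)
    (f : 'I_k -> X -> X) (U : set X) : \bar R :=
  ereal_sup [set e | exists x1 x2 : X,
    [/\ U x1, U x2 & e = ifs_dist f x1 x2]].

Definition ifs_sensitive (R : realType) (X : metricType R) (k : nat)
    (f : 'I_k -> X -> X) : Prop :=
  exists2 eps : R, 0 < eps &
    forall U : set X, open U -> U !=set0 -> (eps%:E <= ifs_diam f U)%E.

(* Main.v *)
Require Import Defs.
From HB Require Import structures.
From mathcomp Require Import all_boot all_order all_algebra.
From mathcomp Require Import all_classical all_reals all_analysis.

Set Implicit Arguments.
Unset Strict Implicit.
Unset Printing Implicit Defensive.

Import Order.TTheory.
Local Open Scope classical_set_scope.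
Local Open Scope ring_scope.

(** Maps with continuous inverse relation are open and have closed graph; on a
    compact space they are therefore open and closed.  Shrinking [U] to an
    open set whose closure is still in [U], weak topological exactness becomes
    honest exactness: finitely many, hence closed, images of [U] cover [X].

    If the orbit of [x0] misses the ball of radius [eps] around [v], any
    nonempty open [U] contains some [u1] with [S u1 = x0], and [S @` U] being
    open, some [u2] in [U] with [T (S u2) = v].  Since [T (S u1) = T x0] is
    in the orbit of [x0], the map [T \o S] sends [u1] and [u2] at distance at
    least [eps] of each other. *)

Lemma open_image_rel_lsc (X : topologicalType) (g : X -> X) (A : set X) :
  rel_lsc (rel_inv (map_graph g)) -> open A -> open (g @` A).
Proof.
move=> lsc_g /lsc_g; congr (open _); apply/seteqP.
by split=> y [x Ax xy]; exists x.
Qed.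

(** The image is the first projection of the part of the inverse graph over [A]. That part is closed
    in the compact square, so its projection is compact, hence closed as [X] is Hausdorff. *)
Lemma closed_image_rel_inv (X : topologicalType) (g : X -> X) (A : set X) :
  compact [set: X] -> hausdorff_space X ->
  closed (rel_inv (map_graph g)) -> closed A -> closed (g @` A).
Proof.
move=> cptX hX clg clA.
have -> : g @` A = fst @` (rel_inv (map_graph g) `&` snd @^-1` A).
  apply/seteqP; split=> [_ [x Ax <-]|_ [[y x] [/= yx Ax] <-]].
  - by exists (g x, x).
  - by exists x.
apply: compact_closed => //; apply: continuous_compact.
  by apply: continuous_subspaceT => p; exact: cvg_fst.
apply: (subclosed_compact _ (compact_setX cptX cptX)) => //.
apply: closedI => //; apply: closed_comp clA => p _; exact: cvg_snd.
Qed.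

(** Serves with [P] equal to [closed] for covering [X], and to [open] for iterating exactness. *)
Lemma ifs_semigroup_image (X : Type) (k : nat) (f : 'I_k -> X -> X)
    (P : set X -> Prop) (h : X -> X) (A : set X) :
  (forall i B, P B -> P (f i @` B)) -> ifs_semigroup f h -> P A -> P (h @` A).
Proof.
move=> fP hh; elim: hh A => [i A /fP//|g1 g2 _ IH1 _ IH2 A /IH2/IH1].
by rewrite image_comp.
Qed.

Lemma ifs_iter_add (X : Type) (k : nat) (f : 'I_k -> X -> X)
    (w1 w2 : nat -> 'I_k) (m n : nat) :
  exists w, ifs_iter f w (m + n) = ifs_iter f w2 n \o ifs_iter f w1 m.
Proof.
pose w j := if (j < m)%N then w1 j else w2 (j - m)%N.
have wE j : (j <= m)%N -> ifs_iter f w j = ifs_iter f w1 j.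
  by elim: j => //= j IHj jm; rewrite {1}/w jm IHj// ltnW.
exists w; elim: n => [|n IHn] /=; first by rewrite addn0 wE.
by rewrite addnS /= {1}/w ltnNge leq_addr /= addKn IHn.
Qed.

Lemma ifs_semigroup_iter (X : Type) (k : nat) (f : 'I_k -> X -> X)
    (h : X -> X) :
  ifs_semigroup f h -> exists w n, h = ifs_iter f w n.
Proof.
elim=> [i|g1 g2 _ [w1 [n1 ->]] _ [w2 [n2 ->]]].
  by exists (fun=> i), 1%N.
(* In [g1 \o g2] the map [g2] acts first, so its word is read first. *)
have [w <-] := ifs_iter_add f w2 w1 n2 n1.
by exists w, (n2 + n1)%N.
Qed.

Lemma weak_top_exact_onto (X : topologicalType) (k : nat)
    (f : 'I_k -> X -> X) (U : set X) (y : X) :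
  compact [set: X] -> hausdorff_space X ->
  (forall i (A : set X), closed A -> closed (f i @` A)) ->
  weak_top_exact f -> open U -> U !=set0 ->
  exists T u, [/\ ifs_semigroup f T, U u & T u = y].
Proof.
move=> cptX hX clf exf oU [u Uu].
have [B nB BU] : exists2 B, nbhs u B & closure B `<=` U.
  have /(_ U)[|B nB BU] := compact_regular hX cptX (@filterT _ _ (nbhs_filter u)).
    exact: open_nbhs_nbhs.
  by exists B.
have [||N [T [hT dT]]] := exf B°.
- exact: open_interior.
- by exists u.
pose F : set X := \bigcup_(i in [set: 'I_N]) T i @` closure B.
have clF : closed F.
  apply: closed_bigcup => [|i _]; first exact: finite_finset.
  by apply: (@ifs_semigroup_image _ _ f closed) => //; exact: closed_closure.
have : F y.
  (* Otherwise the open complement of [F] would meet the dense union of the images of [B°], which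
     lies in [F]. *)
  apply: contrapT => nFy.
  have [||z [nFz [i _ [b Bb bz]]]] := dT (~` F).
  - by exists y.
  - exact: closed_openC.
  apply: nFz; exists i => //; exists b => //.
  by apply: subset_closure; exact: interior_subset.
by move=> [i _ [b /BU Ub <-]]; exists (T i), b.
Qed.

Theorem theorem3p9 (R : realType) (X : metricType R)
    (compactX : compact [set: X]) (k : nat) (f : 'I_k -> X -> X)
    (f_inv_continuous :
      forall i : 'I_k, rel_continuous (rel_inv (map_graph (f i))))
    (exact_f : weak_top_exact f)
    (not_minimal_f : ~ ifs_minimal f) :
  ifs_sensitive f.
Proof.
have hX : hausdorff_space X := @metric_hausdorff R X.
have opf i (A : set X) : open A -> open (f i @` A).
  by move=> oA; apply: open_image_rel_lsc => //; case: (f_inv_continuous i).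
have clf i (A : set X) : closed A -> closed (f i @` A).
  by move=> cA; apply: closed_image_rel_inv => //; case: (f_inv_continuous i).
have [x0 /denseNE[V [[v nV] V0]]] : exists x0, ~ dense (forward_orbit f x0).
  exact/existsNP.
(* [V] misses the orbit of [x0]. The radius [e] is fixed before [U], so it serves for every [U]. *)
move: nV => /open_nbhs_nbhs/nbhs_ballP[e /= e0 eV].
exists e => // U oU U0.
have [S [u1 [hS Uu1 Su1]]] :=
  weak_top_exact_onto x0 compactX hX clf exact_f oU U0.
have oSU : open (S @` U) by exact: (@ifs_semigroup_image _ _ f open).
have SU0 : S @` U !=set0 by exists x0, u1.
have [T [_ [hT [u2 Uu2 <-] Tv]]] :=
  weak_top_exact_onto v compactX hX clf exact_f oSU SU0.
have [w [n wn]] := ifs_semigroup_iter (ifs_comp hT hS).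
apply: (@le_trans _ _ (ifs_dist f u2 u1)); last first.
  by apply: ereal_sup_ubound; exists u2, u1.
apply: (@le_trans _ _ (mdist v (T x0))%:E); last first.
  apply: ereal_sup_ubound; exists w, n.
  by rewrite -wn /= Su1 Tv.
rewrite lee_fin leNgt; apply/negP => vT.
suff : (V `&` forward_orbit f x0) (T x0) by rewrite V0.
by split; [apply: eV; rewrite ballEmdist|exists T].
Qed.
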